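(* Let $\mathbf{X}$ be a Borel measurable space, $P$ a Markov transition kernel on $\mathbf{X}$ having a unique invariant probability measure $\Pi$. Let $V : \mathbf{X} \to [0,\infty)$ be Borel measurable and suppose there is a constant $K\in(0,\infty)$ with $PV(x)\le K$ for all $x\in\mathbf{X}$. Suppose there are $r>1$, a constant $\alpha_r\in(0,1]$ and a Borel probability measure $\nu$ on $\mathbf{X}$ such that $P(x,B)\ge\alpha_r\nu(B)$ for every Borel $B\subseteq\mathbf{X}$ and every $x$ with $V(x)\le rK$. Let $\gamma_r = 1 - 1/r$, and define $$\lambda_{\pm}(\gamma_r,\alpha_r) = \frac{1-\gamma_r\wedge\alpha_r \pm \sqrt{(1-\gamma_r\wedge\alpha_r)^2 + 4(\gamma_r\wedge\alpha_r)(1-\alpha_r\vee\gamma_r)}}{2}$$ and, for integers $t\ge0$, $$\rho_t(\gamma_r,\alpha_r) = \frac{(1-\lambda_-(\gamma_r,\alpha_r))\,\lambda_+(\gamma_r,\alpha_r)^t - (1-\lambda_+(\gamma_r,\alpha_r))\,\lambda_-(\gamma_r,\alpha_r)^t}{\lambda_+(\gamma_r,\alpha_r)-\lambda_-(\gamma_r,\alpha_r)}.$$ Let $c:[0,\infty)\to[0,\infty)$ be any nondecreasing concave function. Then for all $x\in\mathbf{X}$ and all integers $t\ge0$, $$\left\|P^t(x,\cdot)-\Pi(\cdot)\right\|_{\mathrm{TV}} \le \rho_t(\gamma_r,\alpha_r),\qquad \left\|P^{t+1}(x,\cdot)-\Pi(\cdot)\right\|_{c(V)} \le 2\,c(K)\,\rho_t(\gamma_r,\alpha_r),$$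 and $\lim_{t\to\infty}\rho_t(\gamma_r,\alpha_r)^{1/t} = \lambda_+(\gamma_r,\alpha_r)$.
   Context: $a\wedge b$ and $a\vee b$ denote minimum and maximum, and $0^0=1$. For a Borel function $f$, $Pf(x) = \int_{\mathbf{X}} f(y)\,P(x,dy)$; $P^t$ denotes the $t$-step kernel, with $P^0$ the identity kernel, $P^1=P$. A probability measure $\Pi$ is invariant if $\int P(y,\cdot)\,\Pi(dy)=\Pi(\cdot)$. Total variation is normalized as $\|P^t(x,\cdot)-\Pi\|_{\mathrm{TV}} = \sup_{f:\mathbf{X}\to[0,1]} \left|P^t f(x) - \int f\,d\Pi\right|$ (supremum over Borel $f$). For a Borel function $W:\mathbf{X}\to[0,\infty)$, $\|P^t(x,\cdot)-\Pi\|_{W} = \sup_{|f|\le W} \left|P^t f(x) - \int f\,d\Pi\right|$, the supremum being over Borel functions $f:\mathbf{X}\to\mathbb{R}$ with $|f|\le W$. Here $c(V)$ denotes the function $x\mapsto c(V(x))$. *)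

(* Defs.v *)
From HB Require Import structures.
From mathcomp Require Import all_boot all_order all_algebra.
From mathcomp Require Import all_classical all_reals all_analysis.

Set Implicit Arguments.
Unset Strict Implicit.
Unset Printing Implicit Defensive.

Import Order.TTheory GRing.Theory Num.Theory.
Import numFieldNormedType.Exports.

Local Open Scope classical_set_scope.
Local Open Scope ring_scope.

(* The library only equips [mkcomp_noparam k1 k2], that is
   x |-> \int[k1 x]_y k2 y _, with a subprobability kernel structure. *)
Section kcomp_noparam_probability.
Context d0 d1 d2 (T0 : measurableType d0) (T1 : measurableType d1)
  (T2 : measurableType d2) (R : realType).
Variables (k1 : R.-pker T0 ~> T1) (k2 : R.-pker T1 ~> T2).

Definition pkcomp : T0 -> {measure set T2 -> \bar R} := mkcomp_noparam k1 k2.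

HB.instance Definition _ := Kernel.on pkcomp.

Let pkcomp_prob x : pkcomp x [set: T2] = 1%E.
Proof.
rewrite /pkcomp /mkcomp_noparam /= /kcomp_noparam.
under eq_integral do rewrite prob_kernel.
by rewrite integral_cst// mul1e prob_kernel.
Qed.

HB.instance Definition _ :=
  Kernel_isProbability.Build _ _ _ _ _ pkcomp pkcomp_prob.

End kcomp_noparam_probability.

Section markov.
Context d (X : measurableType d) (R : realType).

(* [ksteps P t x] is P^t(x, .), with
   P^0(x, .) = dirac x and P^(t+1)(x, B) = \int P(x, dy) P^t(y, B) *)
Fixpoint ksteps (P : R.-pker X ~> X) (t : nat) : R.-pker X ~> X :=
  if t is t'.+1 then pkcomp P (ksteps P t')
  else kdirac (@measurable_id _ X setT).

Definition invariant_prob (P : R.-pker X ~> X) (Pi : probability X R) : Prop :=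
  forall B, measurable B -> (\int[Pi]_y P y B = Pi B)%E.

Definition unique_invariant_prob (P : R.-pker X ~> X) (Pi : probability X R) :
    Prop :=
  invariant_prob P Pi /\
  forall Pi' : probability X R, invariant_prob P Pi' ->
    forall B, measurable B -> Pi' B = Pi B.

Definition tv_dist (mu nu : {measure set X -> \bar R}) : \bar R :=
  ereal_sup
    [set `| \int[mu]_x (f x)%:E - \int[nu]_x (f x)%:E |%E | f in
      [set f : X -> R | measurable_fun setT f /\ forall x, 0 <= f x <= 1]].

(* When f is not integrable for mu or nu, the absolute value below is +oo
   (since oo - oo = -oo in \bar R), so a finite upper bound on [weighted_dist]
   includes the integrability of every such f. *)
Definition weighted_dist (W : X -> R) (mu nu : {measure set X -> \bar R}) :
    \bar R :=
  ereal_sup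
    [set `| \int[mu]_x (f x)%:E - \int[nu]_x (f x)%:E |%E | f in
      [set f : X -> R | measurable_fun setT f /\ forall x, `|f x| <= W x]].

End markov.

Section rates.
Context (R : realType).
Implicit Types (gamma alpha : R) (t : nat).

Definition lambda_disc gamma alpha : R :=
  (1 - Num.min gamma alpha) ^+ 2
  + 4 * Num.min gamma alpha * (1 - Num.max alpha gamma).

Definition lambda_plus gamma alpha : R :=
  (1 - Num.min gamma alpha + Num.sqrt (lambda_disc gamma alpha)) / 2.

Definition lambda_minus gamma alpha : R :=
  (1 - Num.min gamma alpha - Num.sqrt (lambda_disc gamma alpha)) / 2.

Definition rho t gamma alpha : R :=
  ((1 - lambda_minus gamma alpha) * lambda_plus gamma alpha ^+ t
   - (1 - lambda_plus gamma alpha) * lambda_minus gamma alpha ^+ t)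
  / (lambda_plus gamma alpha - lambda_minus gamma alpha).

End rates.

Definition concave_function (R : realType) (D : set R) (f : R -> R) : Prop :=
  forall (s : R) (u v : R), 0 <= s <= 1 -> D u -> D v ->
    s * f u + (1 - s) * f v <= f (s * u + (1 - s) * v).

(* Main.v *)
Require Import Defs.
From HB Require Import structures.
From mathcomp Require Import all_boot all_order all_algebra.
From mathcomp Require Import all_classical all_reals all_analysis.
From mathcomp Require Import measurable_realfun ring lra.

Set Implicit Arguments.
Unset Strict Implicit.
Unset Printing Implicit Defensive.

Import Order.TTheory GRing.Theory Num.Theory.
Import numFieldNormedType.Exports.

Local Open Scope classical_set_scope.
Local Open Scope ring_scope.

(** Write C for the sublevel set {V <= r K}, gamma = 1 - 1/r, m and M for the
    minimum and maximum of gamma and alpha. Two facts drive the convergence: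
    by Markov's inequality every transition law gives C mass at least gamma,
    and from C the law P(x, .) dominates alpha nu.

    For bounded measurable g, let u_t be the oscillation of P^t g over the
    whole space and v_t its oscillation over C. Averaging over P(x, .), whose
    mass on C is at least gamma, gives
      u_(t+1) <= gamma v_t + (1 - gamma) u_t.
    If x is in C, the part alpha nu of P(x, .) contributes the same number
    whatever x is, and only the residual measure P(x, .) - alpha nu matters. It
    has mass 1 - alpha, and its mass on C is at least gamma - alpha and at
    least 0, that is, at least gamma - m; hence
      v_(t+1) <= (gamma - m) v_t + (1 - M) u_t.
    When alpha < gamma, ignoring where the residual measure sits would replace
    gamma - m by 0 and give a slower rate. The 2 x 2 matrix of this system has trace 1 - m
    and determinant - m (1 - M), so its eigenvalues are lambda_plus and
    lambda_minus, and the solution started at (1, 1) has first component rho_t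
    ([bracketed_kmean], [rhoS_rhoC], [rhoCS]). Integrating the oscillation bound
    against the invariant law gives the total variation estimate
    ([iter_kmean_cvg]).

    For the weighted norm, let |f| <= c(V). A supporting line of c at K gives
    P|f| <= c(K) everywhere ([concave_mean_le]); so P f takes its values in
    [- c(K), c(K)], and P^(t+1) f = P^t (P f) reduces to the bounded case with
    oscillation 2 c(K).

    For the limit, rho_t = lambda_plus^t (A - B q^t) with A > 0 and
    q = lambda_minus / lambda_plus of absolute value < 1, so the t-th root of
    the second factor tends to 1 ([root_rho_cvg]). *)

(** * Integrals of real functions against probability measures *)

Lemma integrable_of_bound d (X : measurableType d) (R : realType)
    (mu : {measure set X -> \bar R}) (f : X -> R) (M : R) :
  measurable_fun [set: X] f -> (\int[mu]_y `|f y|%:E <= M%:E)%E ->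
  mu.-integrable [set: X] (EFin \o f).
Proof.
move=> mf fM; apply/integrableP; split; first exact/measurable_EFinP.
exact: le_lt_trans fM (ltry _).
Qed.

Lemma normr_Rintegral_le d (X : measurableType d) (R : realType)
    (mu : {measure set X -> \bar R}) (f : X -> R) (M : R) :
  measurable_fun [set: X] f -> (\int[mu]_y `|f y|%:E <= M%:E)%E ->
  `|\int[mu]_y f y| <= M.
Proof.
move=> mf fM; rewrite -lee_fin EFin_normr_Rintegral//.
  apply: le_trans fM; apply: le_trans (le_abse_integral _ _ _) _ => //.
  exact/measurable_EFinP.
exact: integrable_of_bound fM.
Qed.

Lemma EFin_Rintegral d (X : measurableType d) (R : realType)
    (mu : {measure set X -> \bar R}) (f : X -> R) :
  mu.-integrable [set: X] (EFin \o f) ->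
  (\int[mu]_y f y)%:E = (\int[mu]_y (f y)%:E)%E.
Proof. by move=> fi; rewrite fineK//; exact: integrable_fin_num. Qed.

Lemma integral_norm_le d (X : measurableType d) (R : realType)
    (mu : probability X R) (f : X -> R) (M : R) :
  measurable_fun [set: X] f -> (forall x, `|f x| <= M) ->
  (\int[mu]_y `|f y|%:E <= M%:E)%E.
Proof.
move=> mf fM.
rewrite -[leRHS](_ : \int[mu]_y M%:E = _)%E; last first.
  by rewrite integral_cst//= probability_setT mule1.
have M0 : 0 <= M by exact: le_trans (normr_ge0 _) (fM point).
apply: ge0_le_integral => //.
  by apply/measurable_EFinP; exact: measurableT_comp.
by move=> x _; rewrite lee_fin.
Qed.

Lemma integrable_bounded d (X : measurableType d) (R : realType)
    (mu : probability X R) (f : X -> R) (M : R) :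
  measurable_fun [set: X] f -> (forall x, `|f x| <= M) ->
  mu.-integrable [set: X] (EFin \o f).
Proof.
move=> mf fM; apply: integrable_of_bound => //; exact: integral_norm_le.
Qed.

Lemma Rintegral_prob_cst d (X : measurableType d) (R : realType)
    (mu : probability X R) (a : R) : \int[mu]_x a = a.
Proof.
have mT : fine (mu [set: X]) = 1 by rewrite probability_setT.
by rewrite Rintegral_cst// mT mulr1.
Qed.

Lemma Rintegral_funrposneg d (X : measurableType d) (R : realType)
    (mu : {measure set X -> \bar R}) (f : X -> R) :
  mu.-integrable [set: X] (EFin \o f) ->
  \int[mu]_y f y = \int[mu]_y f^\+ y - \int[mu]_y f^\- y.
Proof.
move=> fi; rewrite -RintegralB//; last 2 first.
- exact: integrable_funrpos.
- exact: integrable_funrneg.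
by apply: eq_Rintegral => x _; rewrite -[in LHS](funrposBneg f).
Qed.

(** * Mixtures of kernels *)

(** A mixture is a composition of kernels whose first kernel starts from the
    one-point space, hence is just [mu], and whose second one ignores that
    point. The hypothesis only asks [m] to agree with the mixture on measurable
    sets, so that it covers both an invariant law (m = mu) and the steps of a
    chain. *)
Lemma integral_mixture d d' (Y : measurableType d) (Z : measurableType d')
    (R : realType) (mu : probability Y R) (k : R.-pker Y ~> Z)
    (m : {measure set Z -> \bar R}) (f : Z -> \bar R) :
    (forall B, measurable B -> m B = \int[mu]_y k y B)%E ->
    (forall z, 0 <= f z)%E -> measurable_fun [set: Z] f ->
  (\int[m]_z f z = \int[mu]_y \int[k y]_z f z)%E.
Proof.
move=> mE f0 mf.
pose l := kprobability (measurable_cst (mu : pprobability Y R) :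
  measurable_fun [set: unit] _).
rewrite -(@integral_kcomp _ _ _ _ _ _ _ l (kernel.kernel_snd k) tt)//.
by apply: eq_measure_integral => B mB _; rewrite mE.
Qed.

Section mixture.
Context d d' (Y : measurableType d) (Z : measurableType d') (R : realType).
Variable k : R.-pker Y ~> Z.

Let measurable_Rintegral_kernel_ge0 (f : Z -> R) :
  (forall z, 0 <= f z) -> measurable_fun [set: Z] f ->
  measurable_fun [set: Y] (fun y => \int[k y]_z f z).
Proof.
move=> f0 mf; rewrite /Rintegral.
apply: (measurableT_comp (fine_measurable measurableT)).
apply: measurable_fun_integral_kernel => //.
  by move=> U; exact: measurable_kernel.
exact/measurable_EFinP.
Qed.

Lemma measurable_Rintegral_kernel (f : Z -> R) :
    measurable_fun [set: Z] f ->
    (forall y, (k y).-integrable [set: Z] (EFin \o f)) ->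
  measurable_fun [set: Y] (fun y => \int[k y]_z f z).
Proof.
move=> mf fi; under eq_fun do rewrite Rintegral_funrposneg//.
by apply: measurable_funB; apply: measurable_Rintegral_kernel_ge0 => //;
  [exact: measurable_funrpos|exact: measurable_funrneg].
Qed.

Variables (mu : probability Y R) (m : {measure set Z -> \bar R}).
Hypothesis mE : (forall B, measurable B -> m B = \int[mu]_y k y B)%E.

Let ge0_Rintegral_mixture (f : Z -> R) (M : R) :
    (forall z, 0 <= f z) -> measurable_fun [set: Z] f ->
    (forall y, \int[k y]_z (f z)%:E <= M%:E)%E ->
  [/\ mu.-integrable [set: Y] (EFin \o (fun y => \int[k y]_z f z)),
      (\int[m]_z (f z)%:E <= M%:E)%E &
      \int[m]_z f z = \int[mu]_y \int[k y]_z f z].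
Proof.
move=> f0 mf fM.
have fMn y : (\int[k y]_z `|f z|%:E <= M%:E)%E.
  by under eq_integral do rewrite ger0_norm//.
have mk := measurable_Rintegral_kernel_ge0 f0 mf.
have kM y : `|\int[k y]_z f z| <= M by exact: normr_Rintegral_le.
have mxE : (\int[m]_z (f z)%:E = \int[mu]_y (\int[k y]_z f z)%:E)%E.
  rewrite (@integral_mixture _ _ _ _ _ mu k)//; last exact/measurable_EFinP.
  apply: eq_integral => y _; rewrite EFin_Rintegral//.
  exact: integrable_of_bound (fMn y).
split => //.
- exact: integrable_bounded kM.
- rewrite mxE; apply: le_trans (integral_norm_le mu mk kM).
  by under [leRHS]eq_integral do rewrite ger0_norm ?Rintegral_ge0//.
- by rewrite /Rintegral mxE.
Qed.

(** The uniform bound on the means of |f| passes to the mixture, so that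
    integrability with respect to [m] is a conclusion. *)
Lemma Rintegral_mixture (f : Z -> R) (M : R) :
    measurable_fun [set: Z] f ->
    (forall y, \int[k y]_z `|f z|%:E <= M%:E)%E ->
  (\int[m]_z `|f z|%:E <= M%:E)%E /\
  \int[m]_z f z = \int[mu]_y \int[k y]_z f z.
Proof.
move=> mf fM.
have le_part (g : Z -> R) y : measurable_fun [set: Z] g ->
    (forall z, 0 <= g z <= `|f z|) -> (\int[k y]_z (g z)%:E <= M%:E)%E.
  move=> mg gf; apply: le_trans (fM y); apply: ge0_le_integral => //.
  - by move=> z _; rewrite lee_fin; case/andP: (gf z).
  - exact/measurable_EFinP.
  - by apply/measurable_EFinP; exact: measurableT_comp.
  - by move=> z _; rewrite lee_fin; case/andP: (gf z).
have mp := measurable_funrpos mf; have mn := measurable_funrneg mf.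
have absf z : `|f z| = f^\+ z + f^\- z.
  by rewrite -[LHS]/((Num.norm \o f) z) -funrposDneg.
have fp z : 0 <= f^\+ z <= `|f z|.
  by rewrite funrpos_ge0 absf lerDl funrneg_ge0.
have fn z : 0 <= f^\- z <= `|f z|.
  by rewrite funrneg_ge0 absf lerDr funrpos_ge0.
have mnf : measurable_fun [set: Z] (fun z => `|f z|) by exact: measurableT_comp.
have [_ mM _] := ge0_Rintegral_mixture (fun z => normr_ge0 (f z)) mnf fM.
have [ikp _ Ep] := ge0_Rintegral_mixture (@funrpos_ge0 _ _ f) mp
  (fun y => le_part _ y mp fp).
have [ikn _ En] := ge0_Rintegral_mixture (@funrneg_ge0 _ _ f) mn
  (fun y => le_part _ y mn fn).
split => //.
rewrite Rintegral_funrposneg ?Ep ?En; last exact: integrable_of_bound mM.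
rewrite -RintegralB//; apply: eq_Rintegral => y _.
by rewrite [RHS]Rintegral_funrposneg//; exact: integrable_of_bound (fM y).
Qed.

End mixture.

(** * One step of the chain *)

(** The function hi - (hi - hiC) 1_C - g is nonnegative, so its integral
    against [mu] is at least [beta] times its integral against [nu]; expanding
    both sides is the claim. In other words the residual measure mu - beta nu is
    used without being constructed. With beta = 0 this is the bound by the mass
    of [C] alone. *)
Lemma minorized_mean_le d (X : measurableType d) (R : realType)
    (mu nu : probability X R) (beta : R) (C : set X) (g : X -> R) (hi hiC : R) :
    0 <= beta -> (forall B, measurable B -> (beta%:E * nu B <= mu B)%E) ->
    measurable C ->
    mu.-integrable [set: X] (EFin \o g) -> nu.-integrable [set: X] (EFin \o g) ->
    (forall x, g x <= hi) -> (forall x, C x -> g x <= hiC) ->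
  \int[mu]_x g x - beta * \int[nu]_x g x <=
    (1 - beta) * hi - (hi - hiC) * (fine (mu C) - beta * fine (nu C)).
Proof.
move=> beta0 mnu mC gmu gnu ghi ghiC.
pose h x := (hi - (hi - hiC) * \1_C x) - g x.
have h0 x : 0 <= h x.
  rewrite /h indicE; have [xC|xC] := boolP (x \in C).
    by rewrite mulr1 subKr subr_ge0 ghiC//; exact: set_mem.
  by rewrite mulr0 subr0 subr_ge0.
have iC (m : probability X R) : m.-integrable [set: X] (EFin \o \1_C).
  apply: (@integrable_bounded _ _ _ _ _ 1) => //.
  by move=> x; rewrite indicE; case: (_ \in _); rewrite ?normr1 ?normr0.
have icst (m : probability X R) a : m.-integrable [set: X] (EFin \o cst a).
  exact: (@integrable_bounded _ _ _ _ _ `|a|).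
have icC (m : probability X R) a :
    m.-integrable [set: X] (EFin \o (fun x => a * \1_C x)).
  exact: (integrableZl measurableT a (iC m)).
have iB (m : probability X R) : m.-integrable [set: X]
    (EFin \o (fun x => hi - (hi - hiC) * \1_C x)).
  exact: (integrableB measurableT (icst m hi) (icC m (hi - hiC))).
have ih (m : probability X R) : m.-integrable [set: X] (EFin \o g) ->
    m.-integrable [set: X] (EFin \o h).
  by move=> gm; exact: (integrableB measurableT (iB m) gm).
have hE (m : probability X R) : m.-integrable [set: X] (EFin \o g) ->
    \int[m]_x h x = hi - (hi - hiC) * fine (m C) - \int[m]_x g x.
  move=> gm; rewrite [LHS](RintegralB measurableT (iB m) gm).
  rewrite (RintegralB measurableT (icst m hi) (icC m (hi - hiC))).
  rewrite Rintegral_prob_cst (RintegralZl _ measurableT (iC m)).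
  by rewrite /Rintegral integral_indic// setIT.
have : beta * \int[nu]_x h x <= \int[mu]_x h x.
  rewrite -lee_fin EFinM !EFin_Rintegral; [|exact: ih..].
  have mh : measurable_fun [set: X] (EFin \o h) by case/integrableP: (ih _ gmu).
  rewrite -[beta]/((NngNum beta0)%:num) -(ge0_integral_mscale nu)//; last first.
    by move=> x _; rewrite lee_fin.
  by apply: ge0_le_measure_integral => // x; rewrite lee_fin.
rewrite !hE//; lra.
Qed.

(** The law P(x, .) bundled as a probability measure, so that the lemmas on
    probability measures apply to it. *)
Section kernel_prob.
Context d (X : measurableType d) (R : realType) (P : R.-pker X ~> X) (x : X).

Definition kernel_prob : set X -> \bar R := P x.

HB.instance Definition _ := Measure.on kernel_prob.

HB.instance Definition _ :=
  Measure_isProbability.Build _ _ _ kernel_prob (prob_kernel x).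

End kernel_prob.

(** [g] oscillates by at most [u] on the whole space and by at most [v] on [C].
    Explicit bounds, rather than suprema and infima, make the one-step estimate
    a computation on four numbers. *)
Definition bracketed d (X : measurableType d) (R : realType) (C : set X)
    (g : X -> R) (u v : R) : Prop :=
  exists lo hi loC hiC : R,
    [/\ forall x, lo <= g x <= hi, forall x, C x -> loC <= g x <= hiC,
        lo <= loC, hiC <= hi & hi - lo <= u /\ hiC - loC <= v].

Section step.
Context d (X : measurableType d) (R : realType).
Variables (P : R.-pker X ~> X) (nu : probability X R) (C : set X).
Variables (gamma alpha : R).
Hypothesis mC : measurable C.
Hypothesis gamma01 : 0 <= gamma <= 1.
Hypothesis alpha01 : 0 <= alpha <= 1.
Hypothesis PC : forall x, gamma <= fine (P x C).
Hypothesis minor :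
  forall B x, measurable B -> C x -> (alpha%:E * nu B <= P x B)%E.

Definition kmean (f : X -> R) (x : X) : R := \int[P x]_y f y.

Let m := Num.min gamma alpha.
Let M := Num.max alpha gamma.

(** The second bound contains the mean of [g] under [nu], which does not depend
    on the starting point: it disappears from the oscillation on [C]. *)
Lemma kmean_le (g : X -> R) hi hiC : measurable_fun [set: X] g ->
    (exists b : R, forall x, `|g x| <= b) -> hiC <= hi ->
    (forall x, g x <= hi) -> (forall x, C x -> g x <= hiC) ->
  (forall x, kmean g x <= gamma * hiC + (1 - gamma) * hi) /\
  (forall x, C x -> kmean g x <=
    alpha * \int[nu]_y g y + (gamma - m) * hiC + (1 - M) * hi).
Proof.
move=> mg [b gb] hiCle ghi ghiC.
have ig (mu : probability X R) : mu.-integrable [set: X] (EFin \o g).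
  exact: integrable_bounded gb.
pose Px x : probability X R := kernel_prob P x.
have PxC x : gamma <= fine (Px x C) by exact: PC.
have KE x : kmean g x = \int[Px x]_y g y by [].
split=> [x|x Cx]; rewrite KE.
  (* For an arbitrary x only the mass of C is known: take beta = 0. *)
  have := @minorized_mean_le _ _ _ (Px x) nu 0 C g hi hiC _ _ mC
    (ig _) (ig _) ghi ghiC.
  rewrite lexx => /(_ isT).
  have H0 B : measurable B -> (0%:E * nu B <= Px x B)%E by rewrite mul0e.
  move=> /(_ H0).
  have : 0 <= (hi - hiC) * (fine (Px x C) - gamma).
    by rewrite mulr_ge0 ?subr_ge0.
  by nra.
have := @minorized_mean_le _ _ _ (Px x) nu alpha C g hi hiC _ _ mC
  (ig _) (ig _) ghi ghiC.
case/andP: (alpha01) => a0 a1; move=> /(_ a0).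
have H0 B : measurable B -> (alpha%:E * nu B <= Px x B)%E.
  by move=> mB; exact: minor.
move=> /(_ H0).
have : 0 <= (hi - hiC) * (fine (Px x C) - alpha * fine (nu C) - (gamma - m)).
  rewrite mulr_ge0 ?subr_ge0//.
  (* The residual mass of C is at least 0 and at least gamma - alpha, hence at
     least gamma - m. *)
  have nuC1 : alpha * fine (nu C) <= alpha.
    rewrite ler_piMr// -lee_fin fineK ?fin_num_measure//; exact: probability_le1.
  have PnuC : alpha * fine (nu C) <= fine (Px x C).
    rewrite -lee_fin EFinM !fineK ?fin_num_measure//; exact: H0.
  have := PxC x; rewrite /m; case: (leP gamma alpha); lra.
rewrite /m /M; case: (leP gamma alpha); nra.
Qed.

Lemma kmean_measurable (g : X -> R) : measurable_fun [set: X] g ->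
  (exists b : R, forall x, `|g x| <= b) -> measurable_fun [set: X] (kmean g).
Proof.
move=> mg [b gb]; apply: measurable_Rintegral_kernel => // x.
exact: (@integrable_bounded _ _ _ (kernel_prob P x) _ _ mg gb).
Qed.

Lemma bracketed_bounded (g : X -> R) u v :
  bracketed C g u v -> exists b : R, forall x, `|g x| <= b.
Proof.
case=> lo [hi [_ [_ [ghi _ _ _ _]]]]; exists (`|lo| + `|hi|) => x.
have /andP[g1 g2] := ghi x; rewrite ler_norml; apply/andP; split.
  by have := ler_norm (- lo); rewrite normrN; have := normr_ge0 hi; lra.
by have := ler_norm hi; have := normr_ge0 lo; lra.
Qed.

(** The lower bounds are the upper bounds [kmean_le] of - g. The two matrix rows
    (gamma, 1 - gamma) and (gamma - m, 1 - M) are those whose powers [rho]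
    describes. *)
Lemma bracketed_kmean (g : X -> R) u v :
    measurable_fun [set: X] g -> bracketed C g u v ->
  bracketed C (kmean g) (gamma * v + (1 - gamma) * u)
    ((gamma - m) * v + (1 - M) * u).
Proof.
move=> mg gB; have [b gb] := bracketed_bounded gB.
have ex_gb : exists b : R, forall x, `|g x| <= b by exists b.
case: gB => lo [hi [loC [hiC [glh glhC loloC hiChi [hu hv]]]]].
have ghi x : g x <= hi by case/andP: (glh x).
have ghiC x : C x -> g x <= hiC by move/glhC => /andP[].
have [up upC] := kmean_le mg ex_gb hiChi ghi ghiC.
pose g' (x : X) : R := -1 * g x.
have loN : - loC <= - lo by rewrite lerN2.
have mg' : measurable_fun [set: X] g' by exact: measurable_funM.
have glo x : g' x <= - lo by case/andP: (glh x); rewrite /g'; lra.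
have gloC x : C x -> g' x <= - loC by move/glhC => /andP[]; rewrite /g'; lra.
have ex_gb' : exists b : R, forall x, `|g' x| <= b.
  by exists b => x; rewrite /g' mulN1r normrN.
have ig (mu : probability X R) : mu.-integrable [set: X] (EFin \o g).
  exact: integrable_bounded gb.
have [dn dnC] := kmean_le mg' ex_gb' loN glo gloC.
have kN x : kmean g' x = - kmean g x.
  by rewrite [LHS](RintegralZl _ measurableT (ig (kernel_prob P x))) mulN1r.
have nuN : \int[nu]_x g' x = - \int[nu]_x g x.
  by rewrite [LHS](RintegralZl _ measurableT (ig nu)) mulN1r.
set hi' := gamma * hiC + (1 - gamma) * hi.
set lo' := gamma * loC + (1 - gamma) * lo.
set hiC' := alpha * \int[nu]_y g y + (gamma - m) * hiC + (1 - M) * hi.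
set loC' := alpha * \int[nu]_y g y + (gamma - m) * loC + (1 - M) * lo.
have {}dn x : lo' <= kmean g x by have := dn x; rewrite kN /lo'; lra.
have {}dnC x : C x -> loC' <= kmean g x.
  by move=> /dnC; rewrite kN nuN /loC'; lra.
(* The bounds on C need not lie between the global ones, since nu may charge
   the complement of C: truncating them restores the nesting. *)
exists lo', hi', (Num.max lo' loC'), (Num.min hi' hiC'); split.
- by move=> x; rewrite dn up.
- by move=> x Cx; rewrite ge_max le_min dn dnC// up upC.
- by rewrite le_max lexx.
- by rewrite ge_min lexx.
have /andP[g0 g1] := gamma01; have /andP[a0 a1] := alpha01.
have m_le : m <= gamma by rewrite /m ge_min lexx.
have M_le : M <= 1 by rewrite /M ge_max a1 g1.
split.
  have : gamma * (hiC - loC) <= gamma * v by rewrite ler_wpM2l.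
  have : (1 - gamma) * (hi - lo) <= (1 - gamma) * u.
    by rewrite ler_wpM2l ?subr_ge0.
  by rewrite /hi' /lo'; lra.
have : (gamma - m) * (hiC - loC) <= (gamma - m) * v.
  by rewrite ler_wpM2l ?subr_ge0.
have : (1 - M) * (hi - lo) <= (1 - M) * u by rewrite ler_wpM2l ?subr_ge0.
have : Num.min hi' hiC' <= hiC' by rewrite ge_min lexx orbT.
have : loC' <= Num.max lo' loC' by rewrite le_max lexx orbT.
by rewrite /hiC' /loC'; lra.
Qed.

End step.

(** * The rates *)

Section rate_recursion.
Context (R : realType) (gamma alpha : R).
Hypothesis gamma01 : 0 < gamma < 1.
Hypothesis alpha01 : 0 < alpha <= 1.

Let m := Num.min gamma alpha.
Let M := Num.max alpha gamma.
Let lp := lambda_plus gamma alpha.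
Let lm := lambda_minus gamma alpha.

Let m_gt0 : 0 < m.
Proof. by rewrite lt_min; case/andP: gamma01 => ->; case/andP: alpha01 => ->. Qed.

Let m_lt1 : m < 1.
Proof. by rewrite gt_min; case/andP: gamma01 => _ ->. Qed.

Let M_le1 : M <= 1.
Proof.
by rewrite ge_max; case/andP: alpha01 => _ ->; case/andP: gamma01 => _ /ltW.
Qed.

Lemma lambda_plus_add_minus : lp + lm = 1 - m.
Proof. by rewrite /lp /lm /lambda_plus /lambda_minus -/m; field. Qed.

Let disc_gt0 : 0 < lambda_disc gamma alpha.
Proof.
rewrite /lambda_disc -/m -/M ltr_pwDl//.
  by rewrite exprn_gt0// subr_gt0.
by rewrite !mulr_ge0 ?subr_ge0// ltW.
Qed.

Lemma lambda_plus_mul_minus : lp * lm = - (m * (1 - M)).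
Proof.
have := sqr_sqrtr (ltW disc_gt0).
rewrite /lp /lm /lambda_plus /lambda_minus -/m => E.
rewrite [LHS](_ : _ =
    ((1 - m) ^+ 2 - Num.sqrt (lambda_disc gamma alpha) ^+ 2) / 4).
  by rewrite E /lambda_disc -/m -/M; field.
by field.
Qed.

Lemma lambda_minus_lt_plus : lm < lp.
Proof.
rewrite -subr_gt0 (_ : lp - lm = Num.sqrt (lambda_disc gamma alpha)).
  by rewrite sqrtr_gt0.
by rewrite /lp /lm /lambda_plus /lambda_minus; field.
Qed.

Lemma lambda_plus_gt0 : 0 < lp.
Proof.
have := lambda_minus_lt_plus; have := lambda_plus_add_minus; have := m_lt1; lra.
Qed.

Lemma lambda_minus_le0 : lm <= 0.
Proof.
rewrite -(pmulr_rle0 _ lambda_plus_gt0) lambda_plus_mul_minus oppr_le0.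
by rewrite mulr_ge0 ?subr_ge0// ltW.
Qed.

Let lplm : lp - lm != 0.
Proof. by rewrite subr_eq0 gt_eqF// lambda_minus_lt_plus. Qed.

Lemma rho0 : rho 0 gamma alpha = 1.
Proof. by rewrite /rho -/lp -/lm !expr0; field. Qed.

Lemma rho1 : rho 1 gamma alpha = 1.
Proof. by rewrite /rho -/lp -/lm !expr1; field. Qed.

Lemma rhoSS t : rho t.+2 gamma alpha =
  (1 - m) * rho t.+1 gamma alpha + m * (1 - M) * rho t gamma alpha.
Proof.
rewrite -lambda_plus_add_minus -[m * (1 - M)]opprK -lambda_plus_mul_minus.
by rewrite /rho -/lp -/lm !exprS; field.
Qed.

(** The second component of the solution of the linear system whose first
    component is [rho]; it bounds the oscillation on the set [C] as [rho] bounds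
    the global one. *)
Definition rhoC t : R :=
  (rho t.+1 gamma alpha - (1 - gamma) * rho t gamma alpha) / gamma.

Let gamma_neq0 : gamma != 0.
Proof. by rewrite gt_eqF//; case/andP: gamma01. Qed.

Lemma rhoC0 : rhoC 0 = 1.
Proof. by rewrite /rhoC rho0 rho1; field. Qed.

Lemma rhoS_rhoC t : rho t.+1 gamma alpha =
  gamma * rhoC t + (1 - gamma) * rho t gamma alpha.
Proof. by rewrite /rhoC; field. Qed.

(** Cayley-Hamilton for the matrix with rows (gamma, 1 - gamma) and
    (gamma - m, 1 - M), whose determinant is - m (1 - M) in both cases
    m = gamma and m = alpha. *)
Lemma rhoCS t : rhoC t.+1 = (gamma - m) * rhoC t + (1 - M) * rho t gamma alpha.
Proof.
rewrite /rhoC rhoSS; apply: (mulfI gamma_neq0).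
by rewrite /m /M; case: (leP gamma alpha) => _; field.
Qed.

(** Since m < 1, the eigenvalues have a positive sum, so lambda_plus strictly
    dominates the nonpositive lambda_minus in absolute value. *)
Lemma root_rho_cvg :
  (rho t gamma alpha `^ (t%:R^-1)) @[t --> \oo] --> lp.
Proof.
pose q := lm / lp.
pose A := (1 - lm) / (lp - lm).
pose B := (1 - lp) / (lp - lm).
have lp_neq0 : lp != 0 by rewrite gt_eqF// lambda_plus_gt0.
have lplm0 : 0 < lp - lm by rewrite subr_gt0 lambda_minus_lt_plus.
have A0 : 0 < A by rewrite divr_gt0//; have := lambda_minus_le0; lra.
have q1 : `|q| < 1.
  rewrite normrM normfV (gtr0_norm lambda_plus_gt0) ltr_pdivrMr ?lambda_plus_gt0//.
  rewrite mul1r ler0_norm ?lambda_minus_le0//.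
  by have := lambda_plus_add_minus; have := m_lt1; lra.
pose h t := A - B * q ^+ t.
have rhoE t : rho t gamma alpha = lp ^+ t * h t.
  have qE : lp ^+ t * q ^+ t = lm ^+ t.
    by rewrite -exprMn /q mulrCA divff// mulr1.
  rewrite /h mulrBr [lp ^+ t * (B * _)]mulrCA qE /rho -/lp -/lm /A /B; field.
  by [].
have h_cvg : h t @[t --> \oo] --> A.
  rewrite -[X in _ --> X]subr0 -[X in _ - X](mulr0 B).
  apply: cvgB; first exact: cvg_cst.
  by apply: cvgM; [exact: cvg_cst|exact: cvg_expr].
have h_gt0 : \forall t \near \oo, 0 < h t by exact: (cvgr_gt _ h_cvg).
have inv_cvg : (t%:R^-1 : R) @[t --> \oo] --> 0.
  apply/gtr0_cvgV0; last exact: cvgr_idn.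
  by near=> t; rewrite ltr0n; near: t; exact: nbhs_infty_gt.
have ln_cvg : ln (h t) @[t --> \oo] --> ln A.
  exact: (continuous_cvg _ (continuous_ln A0) h_cvg).
have exp_cvg : lp * expR (t%:R^-1 * ln (h t)) @[t --> \oo] --> lp.
  rewrite [X in _ --> X](_ : lp = lp * expR (0 * ln A)); last first.
    by rewrite mul0r expR0 mulr1.
  apply: cvgM; first exact: cvg_cst.
  apply: continuous_cvg; first exact: continuous_expR.
  exact: cvgM.
apply: cvg_trans exp_cvg; apply: near_eq_cvg.
near=> t.
have t0 : (0 < t)%N by near: t; exact: nbhs_infty_gt.
have ht : 0 < h t by near: t.
rewrite rhoE powRM ?exprn_ge0 ?(ltW lambda_plus_gt0)// ?ltW//.
rewrite -powR_mulrn ?(ltW lambda_plus_gt0)// -powRrM divff ?pnatr_eq0 -?lt0n//.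
rewrite powRr1 ?(ltW lambda_plus_gt0)//.
by rewrite /powR gt_eqF.
Unshelve. all: end_near.
Qed.

End rate_recursion.

(** * The chain and its invariant law *)

Section chain.
Context d (X : measurableType d) (R : realType).
Variables (P : R.-pker X ~> X) (Pi : probability X R).

(** An unbounded [f] is allowed, at the price of at least one step: P f is then
    bounded. *)
Lemma ksteps_mean (f : X -> R) (M : R) t x : measurable_fun [set: X] f ->
    (forall y, \int[P y]_z `|f z|%:E <= M%:E)%E ->
  (\int[ksteps P t.+1 x]_z `|f z|%:E <= M%:E)%E /\
  \int[ksteps P t.+1 x]_z f z = iter t.+1 (kmean P) f x.
Proof.
move=> mf fM; elim: t x => [|t IHt] x.
  have ksteps1 (g : X -> \bar R) :
      (\int[ksteps P 1 x]_z g z = \int[P x]_z g z)%E.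
    apply: eq_measure_integral => B mB _.
    by rewrite /= /kcomp_noparam /= integral_indic// setIT.
  by split; rewrite /Rintegral ksteps1.
(* By definition, P^(t+2)(x, .) is the P(x, .)-mixture of the P^(t+1)(y, .). *)
have [] := @Rintegral_mixture _ _ X X R (ksteps P t.+1) (kernel_prob P x)
  (ksteps P t.+2 x) (fun _ _ => erefl) f M mf (fun y => (IHt y).1).
move=> -> ->; split => //; apply: eq_Rintegral => y _.
exact: (IHt y).2.
Qed.

Lemma ksteps_mean_bounded (f : X -> R) (b : R) t x :
    measurable_fun [set: X] f ->
    (forall y, `|f y| <= b) ->
  (\int[ksteps P t x]_z `|f z|%:E <= b%:E)%E /\
  \int[ksteps P t x]_z f z = iter t (kmean P) f x.
Proof.
move=> mf fb; case: t => [|t].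
  have dirac_mean (g : X -> R) : measurable_fun [set: X] g ->
      (\int[ksteps P 0 x]_z (g z)%:E = (g x)%:E)%E.
    move=> mg; rewrite /= /kdirac integral_dirac ?diracT ?mul1e//.
    exact/measurable_EFinP.
  split; last by rewrite /Rintegral dirac_mean.
  by rewrite dirac_mean ?lee_fin//; exact: measurableT_comp.
apply: ksteps_mean => // y.
exact: (@integral_norm_le _ _ _ (kernel_prob P y)).
Qed.

Hypothesis Pi_inv : invariant_prob P Pi.

Lemma invariant_mean (f : X -> R) (M : R) : measurable_fun [set: X] f ->
    (forall y, \int[P y]_z `|f z|%:E <= M%:E)%E ->
  (\int[Pi]_z `|f z|%:E <= M%:E)%E /\ \int[Pi]_z f z = \int[Pi]_z kmean P f z.
Proof.
move=> mf fM; apply: Rintegral_mixture => // B mB.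
by rewrite Pi_inv.
Qed.

Lemma osc_mean_le (g : X -> R) (b e : R) x : measurable_fun [set: X] g ->
    (forall y, `|g y| <= b) -> (forall y, `|g x - g y| <= e) ->
  `|g x - \int[Pi]_y g y| <= e.
Proof.
move=> mg gb ge.
have ig : Pi.-integrable [set: X] (EFin \o g) by exact: integrable_bounded gb.
have icst a : Pi.-integrable [set: X] (EFin \o cst a).
  exact: (@integrable_bounded _ _ _ _ _ `|a|).
have hi : \int[Pi]_y g y <= \int[Pi]_y (g x + e).
  apply: le_Rintegral => //; first exact: icst.
  move=> y _ /=.
  by have := ge y; rewrite ler_norml => /andP[]; lra.
have lo : \int[Pi]_y (g x - e) <= \int[Pi]_y g y.
  apply: le_Rintegral => //; first exact: icst.
  move=> y _ /=.
  by have := ge y; rewrite ler_norml => /andP[]; lra.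
by move: hi lo; rewrite !Rintegral_prob_cst ler_norml => hi lo; apply/andP; split; lra.
Qed.

Variables (nu : probability X R) (C : set X) (gamma alpha : R).
Hypothesis mC : measurable C.
Hypothesis gamma01 : 0 < gamma < 1.
Hypothesis alpha01 : 0 < alpha <= 1.
Hypothesis PC : forall x, gamma <= fine (P x C).
Hypothesis minor :
  forall B x, measurable B -> C x -> (alpha%:E * nu B <= P x B)%E.

Lemma bracketed_iter_kmean (g : X -> R) (lo hi : R) t :
    measurable_fun [set: X] g -> (forall x, lo <= g x <= hi) ->
  measurable_fun [set: X] (iter t (kmean P) g) /\
  bracketed C (iter t (kmean P) g)
    ((hi - lo) * rho t gamma alpha) ((hi - lo) * rhoC gamma alpha t).
Proof.
have g01 : 0 <= gamma <= 1 by case/andP: gamma01 => /ltW -> /ltW ->.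
have a01 : 0 <= alpha <= 1 by case/andP: alpha01 => /ltW -> ->.
move=> mg glh; elim: t => [|t [mt Bt]].
  split => //; exists lo, hi, lo, hi.
  by rewrite rho0// rhoC0// !mulr1; split.
split; first by apply: kmean_measurable => //; exact: bracketed_bounded Bt.
have := bracketed_kmean mC g01 a01 PC minor mt Bt.
rewrite rhoS_rhoC// rhoCS//.
by rewrite !mulrDr ![(hi - lo) * (_ * _)]mulrCA.
Qed.

(** By invariance the mean of P^t g under [Pi] is that of [g], and a function is
    within its oscillation of any of its means. *)
Lemma iter_kmean_cvg (g : X -> R) (lo hi : R) t x :
    measurable_fun [set: X] g -> (forall x, lo <= g x <= hi) ->
  `|iter t (kmean P) g x - \int[Pi]_y g y| <= (hi - lo) * rho t gamma alpha.
Proof.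
move=> mg glh.
have it n := bracketed_iter_kmean n mg glh.
have <- : \int[Pi]_y iter t (kmean P) g y = \int[Pi]_y g y.
  elim: t => [//|t <-]; have [mt Bt] := it t.
  have [b tb] := bracketed_bounded Bt.
  have [//|_ ->//] := @invariant_mean _ b mt.
  by move=> y; exact: (@integral_norm_le _ _ _ (kernel_prob P y)).
have [mt Bt] := it t; have [b tb] := bracketed_bounded Bt.
apply: osc_mean_le tb _ => // y.
case: Bt => [lo' [hi' [_ [_ [tlh _ _ _ [hu _]]]]]].
have /andP[x1 x2] := tlh x; have /andP[y1 y2] := tlh y.
by rewrite ler_norml; apply/andP; split; lra.
Qed.

End chain.

(** * The moment bounds *)

(** The slope is the supremum of the chord slopes to the right of K. By
    concavity these are bounded by every chord slope to the left of K, which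
    exists as K is interior, and monotonicity makes them nonnegative. *)
Lemma concave_supporting_line (R : realType) (c : R -> R) (K : R) :
    0 < K -> (forall u v, 0 <= u -> u <= v -> c u <= c v) ->
    concave_function [set u | 0 <= u] c ->
  exists2 s, 0 <= s & forall v, 0 <= v -> c v <= c K + s * (v - K).
Proof.
move=> K0 cnd ccv.
pose slope v := (c v - c K) / (v - K).
pose S := [set slope v | v in [set v | K < v]].
have three u v : 0 <= u -> u < K -> K < v ->
    (c v - c K) * (K - u) <= (c K - c u) * (v - K).
  move=> u0 uK Kv.
  have vu : 0 < v - u by lra.
  pose s := (v - K) / (v - u).
  have s01 : 0 <= s <= 1.
    have vK0 : 0 <= v - K by lra.
    by rewrite /s (divr_ge0 vK0 (ltW vu)) ler_pdivrMr// mul1r; lra.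
  have := ccv s u v s01 u0 (ltW (le_lt_trans u0 (lt_trans uK Kv))).
  have -> : s * u + (1 - s) * v = K by rewrite /s; field; rewrite gt_eqF.
  have s1 : 1 - s = (K - u) / (v - u) by rewrite /s; field; rewrite gt_eqF.
  rewrite s1 /s -(ler_pM2r vu) => H.
  have E : ((v - K) / (v - u) * c u + (K - u) / (v - u) * c v) * (v - u) =
    (v - K) * c u + (K - u) * c v by field; rewrite gt_eqF.
  by move: H; rewrite E; lra.
have Sub v : K < v ->
    forall u, 0 <= u -> u < K -> slope v <= (c K - c u) / (K - u).
  move=> Kv u u0 uK; rewrite /slope ler_pdivrMr ?subr_gt0// mulrAC.
  by rewrite ler_pdivlMr ?subr_gt0// three.
have hS : has_sup S.
  split; first by exists (slope (K + 1)); exists (K + 1) => //=; lra.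
  exists ((c K - c 0) / (K - 0)) => _ [v /= Kv <-]; exact: Sub.
have slopeS v : K < v -> slope v <= sup S.
  by move=> Kv; apply: ub_le_sup; [case: hS|exists v].
exists (sup S).
  apply: le_trans (slopeS (K + 1) _); last by lra.
  by rewrite /slope divr_ge0 ?subr_ge0 ?cnd//; lra.
move=> v v0; have [vK|Kv|->] := ltgtP v K; last by lra.
- have : sup S <= (c K - c v) / (K - v).
    by apply: ge_sup; [case: hS|move=> _ [w /= Kw <-]; exact: Sub].
  by rewrite ler_pdivlMr ?subr_gt0//; lra.
- by have := slopeS v Kv; rewrite /slope ler_pdivrMr ?subr_gt0//; lra.
Qed.

(** Jensen's inequality for c(V), by integrating the supporting line at K. The
    domination of |f| by an affine function of V avoids any discussion of the
    measurability of c, and the nonnegative slope turns the mean of V into its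
    bound K. *)
Lemma concave_mean_le d (X : measurableType d) (R : realType)
    (mu : probability X R) (V f : X -> R) (c : R -> R) (K : R) :
    (forall x, 0 <= V x) -> measurable_fun [set: X] V -> 0 < K ->
    (\int[mu]_y (V y)%:E <= K%:E)%E ->
    (forall u, 0 <= u -> 0 <= c u) ->
    (forall u v, 0 <= u -> u <= v -> c u <= c v) ->
    concave_function [set u | 0 <= u] c ->
    measurable_fun [set: X] f -> (forall x, `|f x| <= c (V x)) ->
  (\int[mu]_y `|f y|%:E <= (c K)%:E)%E.
Proof.
move=> V0 mV K0 VK c0 cnd ccv mf fcV.
have [s s0 cs] := concave_supporting_line K0 cnd ccv.
(* The constant term bounds c(0) from above. *)
have a0 : 0 <= c K - s * K by have := c0 0 (lexx 0); have := cs 0 (lexx 0); lra.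
have mVE : measurable_fun [set: X] (EFin \o V) by exact/measurable_EFinP.
apply: (@le_trans _ _ (\int[mu]_y ((c K - s * K)%:E + s%:E * (V y)%:E))%E).
  apply: ge0_le_integral => //.
  - by apply/measurable_EFinP; exact: measurableT_comp.
  - by apply: emeasurable_funD => //; exact: measurable_funeM.
  - move=> x _; rewrite -EFinM -EFinD lee_fin (le_trans (fcV x))//.
    by have := cs _ (V0 x); lra.
rewrite ge0_integralD//; last 2 first.
- by move=> x _; rewrite mule_ge0 ?lee_fin.
- exact: measurable_funeM.
rewrite integral_cst//= probability_setT mule1 ge0_integralZl//; last first.
  by move=> x _; rewrite lee_fin.
apply: (@le_trans _ _ ((c K - s * K)%:E + s%:E * K%:E)%E).
  by rewrite leeD2l// lee_wpmul2l ?lee_fin.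
by rewrite -EFinM -EFinD lee_fin; lra.
Qed.

(** Markov's inequality r K 1_{V > r K} <= V for the complement. *)
Lemma markov_sublevel d (X : measurableType d) (R : realType)
    (mu : probability X R) (V : X -> R) (K r : R) :
    (forall x, 0 <= V x) -> measurable_fun [set: X] V -> 0 < K -> 0 < r ->
    (\int[mu]_y (V y)%:E <= K%:E)%E ->
  1 - r^-1 <= fine (mu [set x | V x <= r * K]).
Proof.
move=> V0 mV K0 r0 VK.
set C := [set x | _].
have mC : measurable C.
  rewrite -[C]setTI.
  exact: (measurable_fun_le measurableT mV (measurable_cst _)).
have : ((r * K)%:E * mu (~` C) <= K%:E)%E.
  apply: le_trans VK.
  rewrite -[X in mu X]setIT -integral_indic//; last exact: measurableC.
  rewrite -ge0_integralZl//; last 2 first.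
  - by apply/measurable_EFinP; apply: measurable_indic; exact: measurableC.
  - by rewrite lee_fin mulr_ge0// ltW.
  apply: ge0_le_integral => //.
  - by move=> x _; rewrite mule_ge0 ?lee_fin// mulr_ge0// ltW.
  - apply: measurable_funeM; apply/measurable_EFinP.
    by apply: measurable_indic; exact: measurableC.
  - exact/measurable_EFinP.
  - move=> x _; rewrite -EFinM lee_fin indicE; have [|] := boolP (x \in ~` C).
      by rewrite inE /C /= => /negP; rewrite -ltNge mulr1 => /ltW.
    by rewrite mulr0.
rewrite probability_setC// -[mu C]fineK ?fin_num_measure// -EFinB -EFinM lee_fin /=.
rewrite -mulrA mulrCA ger_pMr// -ler_pdivlMl// mulr1; lra.
Qed.

(** * Convergence *)

Theorem theorem3p1 (R : realType) (d : measure_display) (X : measurableType d)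
  (P : R.-pker X ~> X) (Pi : probability X R)
  (hPi : unique_invariant_prob P Pi)
  (V : X -> R) (V_ge0 : forall x, 0 <= V x) (mV : measurable_fun setT V)
  (K : R) (K_gt0 : 0 < K)
  (hPV : forall x, (\int[P x]_y (V y)%:E <= K%:E)%E)
  (r : R) (r_gt1 : 1 < r)
  (alpha : R) (alpha_gt0 : 0 < alpha) (alpha_le1 : alpha <= 1)
  (nu : probability X R)
  (hminor : forall B x, measurable B -> V x <= r * K ->
     (alpha%:E * nu B <= P x B)%E)
  (c : R -> R) (c_ge0 : forall u, 0 <= u -> 0 <= c u)
  (c_ndecr : forall u v, 0 <= u -> u <= v -> c u <= c v)
  (c_concave : concave_function [set u | 0 <= u] c) :
  let gamma := 1 - r^-1 in
  (forall (x : X) (t : nat),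
     (tv_dist (ksteps P t x) Pi <= (rho t gamma alpha)%:E)%E /\
     (weighted_dist (c \o V) (ksteps P t.+1 x) Pi
        <= (2 * c K * rho t gamma alpha)%:E)%E) /\
  (rho t gamma alpha `^ (t%:R^-1)) @[t --> \oo] --> lambda_plus gamma alpha.
Proof.
move=> gamma.
have r0 : 0 < r by lra.
have g01 : 0 < gamma < 1.
  by rewrite subr_gt0 invf_lt1// r_gt1/= ltrBlDr ltrDl invr_gt0.
have a01 : 0 < alpha <= 1 by rewrite alpha_gt0.
have [Pi_inv _] := hPi.
pose C := [set x | V x <= r * K].
have mC : measurable C.
  rewrite -[C]setTI.
  exact: (measurable_fun_le measurableT mV (measurable_cst _)).
have PC x : gamma <= fine (P x C).
  exact: (markov_sublevel (mu := kernel_prob P x) V_ge0 mV K_gt0 r0 (hPV x)).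
have cvg := iter_kmean_cvg Pi_inv mC g01 a01 PC
  (fun B x mB Cx => hminor B x mB Cx).
split; last exact: root_rho_cvg.
move=> x t; split.
  apply: ge_ereal_sup => _ [f [mf f01] <-].
  have f1 y : `|f y| <= 1 by case/andP: (f01 y) => f0 ?; rewrite ger0_norm.
  have [kfM kfE] := ksteps_mean_bounded P t x mf f1.
  rewrite -EFin_Rintegral ?(integrable_of_bound mf kfM)//.
  rewrite -EFin_Rintegral ?(integrable_bounded Pi mf f1)//.
  rewrite -EFinB /= lee_fin kfE.
  by have := cvg f 0 1 t x mf f01; rewrite subr0 mul1r.
apply: ge_ereal_sup => _ [f [mf fcV] <-].
have fM y : (\int[P y]_z `|f z|%:E <= (c K)%:E)%E.
  exact: (concave_mean_le (mu := kernel_prob P y) V_ge0 mV K_gt0 (hPV y)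
    c_ge0 c_ndecr c_concave mf fcV).
have [kfM kfE] := ksteps_mean t x mf fM.
have [PifM PifE] := invariant_mean Pi_inv mf fM.
rewrite -EFin_Rintegral ?(integrable_of_bound mf kfM)//.
rewrite -EFin_Rintegral ?(integrable_of_bound mf PifM)//.
(* P^(t+1) f = P^t (P f), and P f takes its values in [- c(K), c(K)]. *)
rewrite -EFinB /= lee_fin kfE PifE iterSr.
have -> : 2 * c K = c K - - c K by ring.
apply: cvg => [|y].
  apply: measurable_Rintegral_kernel => // y.
  exact: integrable_of_bound (fM y).
by rewrite -ler_norml; exact: normr_Rintegral_le.
Qed.
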